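(* There exists a prefix-independent bi-positional winning condition that is not permuting. Specifically, let $F_{\{a,b\}}$ be the free group with two generators $a,b$, let $\varepsilon$ be its identity element, let $C=\{a,a^{-1},b,b^{-1},\varepsilon\}$, and let $\le$ be any total order making $F_{\{a,b\}}$ a totally ordered group. Let $W_1\subseteq C^\omega$ be the energy condition over $(F_{\{a,b\}},\le)$ defined by the valuation of colors which maps each element of $C$ to the corresponding element of $F_{\{a,b\}}$. Then $W_1$ is prefix-independent and bi-positional, but not permuting.
   Context: For a set $C$, $C^*$, $C^+$, $C^\omega$ denote the sets of finite, finite non-empty, and infinite words over $C$. For $x\in C^+$, $x^\omega$ is the infinite word $xxx\ldots$. Elements of $C=\{a,a^{-1},b,b^{-1},\varepsilon\}$ are treated as letters, so there is no cancellation in words over $C$. **Permuting.** A winning condition $W\subseteq C^\omega$ that is prefix-independent is permuting if it is closed under permuting periods of periodic sequences: for every $c_1c_2\ldots c_n\in C^+$ and every permutation $\pi$ of $\{1,\ldots,n\}$, $(c_1\ldots c_n)^\omega\in W$ implies $(c_{\pi(1)}\ldots c_{\pi(n)})^\omega\in W$. **Energy conditions.** A totally ordered group is a triple $(G,+,\le)$ where $(G,+)$ is a (not necessarily abelian) group and $\le$ is a total order on $G$ such that $a\le b$ implies $x+a+y\le x+b+y$ for all $a,b,x,y\in G$ (for the free group, the operation is written multiplicatively). A valuation of colors is a function $\mathrm{val}\colon C\to G$, extended to $C^*$ by $\mathrm{val}(\text{empty word})=0$, $\mathrm{val}(c_1\ldots c_n)=\mathrm{val}(c_1)+\ldots+\mathrm{val}(c_n)$.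 The energy condition over $(G,+,\le)$ defined by $\mathrm{val}$ is the set of all $c_1c_2c_3\ldots\in C^\omega$ such that the sequence $\{\mathrm{val}(c_1\ldots c_n)\}_{n=1}^\infty$ has an infinite (strictly) decreasing subsequence w.r.t. $\le$. It is known that free groups admit total orders making them totally ordered groups. **Arenas and games.** An arena over a non-empty finite set (of colors) $C$ is a tuple $\langle V_A,V_B,E\rangle$ where $V_A,V_B$ are disjoint finite sets and $E\subseteq (V_A\cup V_B)\times C\times (V_A\cup V_B)$ is such that every $s\in V_A\cup V_B$ has some $(s,c,t)\in E$. Nodes in $V_A$ are Alice's, nodes in $V_B$ are Bob's. For an edge $e=(s,c,t)$, put $\mathrm{source}(e)=s$, $\mathrm{col}(e)=c$, $\mathrm{target}(e)=t$. The infinite-duration game from a node $s$: starting at $s$, at each turn the owner of the current node chooses an edge whose source is the current node, and the play moves to the target of this edge. This gives an infinite path $e_1,e_2,e_3,\ldots$ (a play). A strategy of a player selects an edge at each of that player's turns depending on the path so far. A winning condition is a set $W\subseteq C^\omega$. A strategy of Alice is winning from $s$ w.r.t. $W$ if every play from $s$ consistent with it satisfies $\mathrm{col}(e_1)\mathrm{col}(e_2)\mathrm{col}(e_3)\ldots\in W$; a strategy of Bob is winning from $s$ w.r.t. $W$ if every play from $s$ consistent with it satisfies $\mathrm{col}(e_1)\mathrm{col}(e_2)\ldots\notin W$. A positional strategy of Alice is a function $\sigma\colon V_A\to E$ with $\mathrm{source}(\sigma(u))=u$ for all $u\in V_A$ (whenever at $u$, Alice chooses $\sigma(u)$); positional strategies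 of Bob are defined analogously on $V_B$. $W$ is half-positional if for every (finite) arena over $C$ there is a positional strategy $\sigma$ of Alice such that for every node $s$: if $\sigma$ is not winning w.r.t. $W$ from $s$, then Bob has a winning strategy w.r.t. $W$ from $s$. $W$ is bi-positional if both $W$ and $C^\omega\setminus W$ are half-positional. $W$ is prefix-independent if for all $x\in C^*$, $\alpha\in C^\omega$: $\alpha\in W\iff x\alpha\in W$. *)

(* Defs.v *)
From HB Require Import structures.
From mathcomp Require Import all_boot all_fingroup.
From mathcomp Require Import classical_sets.

Set Implicit Arguments.
Unset Strict Implicit.
Unset Printing Implicit Defensive.

Local Open Scope group_scope.

(** * Free groups *)

Section FreeGroup.
Variable T : choiceType.

(* (x, false) stands for x and (x, true) for its formal inverse. *)
Definition linv (l : T * bool) : T * bool := (l.1, ~~ l.2).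

Definition reduced (w : seq (T * bool)) : bool :=
  sorted (fun l m => m != linv l) w.

Record free_group : Type :=
  FreeGroup { fg_word :> seq (T * bool); fg_reduced : reduced fg_word }.

HB.instance Definition _ := [isSub for fg_word].
HB.instance Definition _ := [Choice of free_group by <:].

Definition push (l : T * bool) (w : seq (T * bool)) : seq (T * bool) :=
  if w is m :: w' then if m == linv l then w' else l :: w else [:: l].

(* [act u v] is the reduced form of [u ++ v] when [v] is reduced. *)
Definition act (u v : seq (T * bool)) : seq (T * bool) := foldr push v u.

Lemma linvK : involutive linv.
Proof. by case=> x s; rewrite /linv /= negbK. Qed.

Lemma linv_neq l : l != linv l.
Proof. by case: l => x [|]; rewrite /linv xpair_eqE /= andbF. Qed.

Lemma push_reduced l w : reduced w -> reduced (push l w).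
Proof.
case: w => [|m w] //= red_w; case: ifPn => [_|neq_ml]; first exact: path_sorted red_w.
by rewrite /reduced /= neq_ml.
Qed.

Lemma act_reduced u v : reduced v -> reduced (act u v).
Proof. by move=> red_v; elim: u => //= l u; apply: push_reduced. Qed.

Lemma push_linv l w : reduced w -> push (linv l) (push l w) = w.
Proof.
case: w => [|m w] red_w /=; first by rewrite linvK eqxx.
case: eqP => [def_m|_] /=; last by rewrite linvK eqxx.
case: w red_w => [|k w] /=; first by rewrite def_m.
case/andP=> neq_km _; rewrite linvK; case: eqP => [def_k|_]; last by rewrite def_m.
by rewrite def_k def_m linvK eqxx in neq_km.
Qed.

Lemma act_cat u1 u2 v : act (u1 ++ u2) v = act u1 (act u2 v).
Proof. exact: foldr_cat. Qed.

Lemma act_push l u v : reduced v -> act (push l u) v = push l (act u v).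
Proof.
case: u => [|m u] //= red_v; case: eqP => [->|] //=.
by have := push_linv (linv l) (act_reduced u red_v); rewrite linvK.
Qed.

Lemma act_act u v w : reduced w -> act (act u v) w = act u (act v w).
Proof. by move=> red_w; elim: u => //= l u IHu; rewrite act_push ?IHu. Qed.

Lemma act_nil w : reduced w -> act w [::] = w.
Proof.
elim: w => //= l w IHw red_w; rewrite IHw; last exact: path_sorted red_w.
by case: w red_w {IHw} => //= m w /andP[/negPf->].
Qed.

Definition rinv (w : seq (T * bool)) : seq (T * bool) := rev (map linv w).

Lemma rinv_reduced w : reduced w -> reduced (rinv w).
Proof.
rewrite /reduced /rinv rev_sorted sorted_map; apply: sub_sorted => l m /=.
by rewrite linvK => neq_ml; apply: contraNneq neq_ml => ->.
Qed.

Lemma rinvK : involutive rinv.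
Proof. by move=> w; rewrite /rinv map_rev revK mapK //; apply: linvK. Qed.

Lemma act_rinvK w v : reduced v -> act (rinv w) (act w v) = v.
Proof.
move=> red_v; elim: w => //= l w IHw.
rewrite /rinv /= rev_cons -cats1 act_cat /= push_linv //.
exact: act_reduced.
Qed.

Definition fg_one : free_group := @FreeGroup [::] isT.
Definition fg_mul (u v : free_group) : free_group :=
  FreeGroup (act_reduced u (fg_reduced v)).
Definition fg_inv (u : free_group) : free_group :=
  FreeGroup (rinv_reduced (fg_reduced u)).

Lemma fg_mulA : associative fg_mul.
Proof.
by move=> u v w; apply: val_inj => /=; rewrite act_act //; apply: fg_reduced.
Qed.

Lemma fg_mul1 : left_id fg_one fg_mul.
Proof. by move=> u; apply: val_inj. Qed.

Lemma fg_mulr1 : right_id fg_one fg_mul.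
Proof. by move=> u; apply: val_inj; apply: act_nil; apply: fg_reduced. Qed.

Lemma fg_mulV : left_inverse fg_one fg_inv fg_mul.
Proof.
move=> u; apply: val_inj => /=.
by rewrite -[X in act _ X](act_nil (fg_reduced u)) act_rinvK.
Qed.

Lemma fg_mulrV : right_inverse fg_one fg_inv fg_mul.
Proof.
move=> u; rewrite -[u in fg_mul u](_ : fg_inv (fg_inv u) = u) ?fg_mulV //.
by apply: val_inj; apply: rinvK.
Qed.

HB.instance Definition _ :=
  isGroup.Build free_group fg_mulA fg_mul1 fg_mulr1 fg_mulV fg_mulrV.

Definition fg_gen (x : T) : free_group := @FreeGroup [:: (x, false)] isT.

End FreeGroup.

Definition F2 : groupType := free_group 'I_2.
Definition gen_a : F2 := fg_gen ord0.
Definition gen_b : F2 := fg_gen ord_max.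

(** * Winning conditions *)

Definition prefix_independent (C : Type) (W : set (nat -> C)) : Prop :=
  forall (x : seq C) (alpha : nat -> C),
    W alpha <->
    W (fun k => if (k < size x)%N then nth (alpha 0%N) x k else alpha (k - size x)%N).

Definition omega_power (C : Type) (n : nat) (c : 'I_n.+1 -> C) : nat -> C :=
  fun k => c (inord (k %% n.+1)).

(* Meaningful for prefix-independent W only. *)
Definition permuting (C : Type) (W : set (nat -> C)) : Prop :=
  forall (n : nat) (c : 'I_n.+1 -> C) (s : 'S_n.+1),
    W (omega_power c) -> W (omega_power (fun i => c (s i))).

(** * Energy conditions *)

Definition ordered_group (G : groupType) (le : rel G) : Prop :=
  [/\ reflexive le, antisymmetric le, transitive le, total le &
      forall a b x y : G, le a b -> le (x * a * y) (x * b * y)].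

Definition word_val (C : Type) (G : groupType) (val : C -> G) (w : seq C) : G :=
  \prod_(c <- w) val c.

(* [f] extracts a strictly decreasing subsequence from the sequence of the
   values of the non-empty prefixes. *)
Definition energy_condition (C : Type) (G : groupType) (le : rel G)
    (val : C -> G) : set (nat -> C) :=
  fun alpha => exists f : nat -> nat,
    [/\ forall k, (0 < f k)%N,
        forall k, (f k < f k.+1)%N &
        forall k, let u n := word_val val (mkseq alpha n) in
          le (u (f k.+1)) (u (f k)) /\ u (f k.+1) <> u (f k)].

(** * Arenas and games *)

Inductive player := Alice | Bob.

(* V_A and V_B are the fibres of [owner]. *)
Record arena (C : finType) := Arena {
  node : finType;
  owner : node -> player;
  edges : {set node * C * node};
  edges_total : forall s : node, exists (c : C) (t : node), (s, c, t) \in edges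
}.

Section Games.
Variables (C : finType) (A : arena C).
Notation V := (node A).
Notation E := (V * C * V)%type.

Definition source (e : E) : V := e.1.1.
Definition color (e : E) : C := e.1.2.
Definition target (e : E) : V := e.2.

Fixpoint finite_path (s : V) (h : seq E) : Prop :=
  if h is e :: h' then
    [/\ e \in edges A, source e = s & finite_path (target e) h']
  else True.

Definition endpoint (s : V) (h : seq E) : V := last s (map target h).

Definition is_play (s : V) (p : nat -> E) : Prop :=
  [/\ source (p 0%N) = s, forall n, p n \in edges A &
      forall n, source (p n.+1) = target (p n)].

(* A strategy for the game from [s] maps the path so far to the next edge; its
   values matter only on paths from [s] that end in a node of player [P]. *)
Definition is_strategy (P : player) (s : V) (tau : seq E -> E) : Prop :=
  forall h, finite_path s h -> owner (endpoint s h) = P ->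
    tau h \in edges A /\ source (tau h) = endpoint s h.

Definition consistent (P : player) (tau : seq E -> E) (p : nat -> E) : Prop :=
  forall n, owner (source (p n)) = P -> p n = tau (mkseq p n).

Definition wins (P : player) (W : set (nat -> C)) (alpha : nat -> C) : Prop :=
  match P with Alice => W alpha | Bob => ~ W alpha end.

Definition winning (P : player) (W : set (nat -> C)) (s : V)
    (tau : seq E -> E) : Prop :=
  forall p, is_play s p -> consistent P tau p -> wins P W (fun n => color (p n)).

(* The values of [sigma] at the opponent's nodes are irrelevant. *)
Definition is_positional (P : player) (sigma : V -> E) : Prop :=
  forall u, owner u = P -> sigma u \in edges A /\ source (sigma u) = u.

Definition positional_strategy (s : V) (sigma : V -> E) : seq E -> E :=
  fun h => sigma (endpoint s h).

End Games.

Definition half_positional (C : finType) (W : set (nat -> C)) : Prop :=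
  forall A : arena C,
    exists2 sigma : node A -> node A * C * node A,
      is_positional Alice sigma &
      forall s : node A,
        ~ winning Alice W s (positional_strategy s sigma) ->
        exists2 tau, is_strategy Bob s tau & winning Bob W s tau.

Definition bi_positional (C : finType) (W : set (nat -> C)) : Prop :=
  half_positional W /\ half_positional (~` W)%classic.

(** * The condition over the free group *)

(* The five colors are distinct elements of the free group, and are inserted
   into it by [val]. *)
Definition color5 : finType :=
  seq_sub [:: gen_a; gen_a^-1; gen_b; gen_b^-1; 1 : F2].

Definition W1 (le : rel F2) : set (nat -> color5) :=
  energy_condition le (fun c : color5 => val c : F2).

(* Main.v *)
Require Import Defs.
From HB Require Import structures.
From mathcomp Require Import all_boot all_fingroup ssralg ssrnum ssrint.
From mathcomp Require Import boolp classical_sets zify.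

(** Every energy condition over a totally ordered group is bi-positional, and
    it fails to be permuting as soon as two colors have non-commuting values
    and the inverses of these values are colors too.

    Call a group element favorable for Alice if it is smaller than the
    identity, and favorable for Bob otherwise. Both classes are closed under
    products and, because the order is invariant on both sides, under
    conjugation; so the favorability of a closed walk of an arena is the same
    from all its starting points and adds up along concatenations. The link
    with the winning condition is [cycles_win]: a play that carries finitely
    many labels, and on which the value between any two occurrences of the same
    label is favorable for a player, is won by that player. In particular a
    positional strategy wins from a node if every closed walk reachable in the
    graph that it leaves is favorable; the node is then called safe.

    Positional determinacy is proved by induction on the number of edges, in
    the manner of Gimbert and Zielonka. For each player [P] there is a
    positional strategy such that every node is either safe for it or the start
    of a winning, possibly non-positional, strategy of the opponent
    ([half_determined]). As two winning strategies of both players from the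
    same node would contradict each other, this property for both players makes
    every node safe for one of the two positional strategies. If [P] has a node
    [u] with several moves, one keeps a single move [e] at [u], for each [e] in
    turn, and applies the induction hypothesis. Whenever [u] is safe for the
    opponent after all these restrictions, the opponent in the full arena
    follows the strategy meant for the move that [P] made last at [u]; cutting
    cycles at the visits of [u] shows that only favorable cycles arise
    ([switching_wins]). If [P] has no choice at all and a node is not safe,
    then repeating an unfavorable cycle forever is a play which the opponent
    wins and which [P] cannot avoid.

    As to permutations, one of the commutators of [x] and [y] and of [y] and
    [x] is smaller than the identity, so that its letters form the period of a
    word in the condition; reordering the period into [x x^-1 y y^-1] gives it
    the value of the identity, and the word leaves the condition. The bare
    existence statement uses the Heisenberg group over the integers, which a
    lexicographic order makes a totally ordered group. *)

Set Implicit Arguments.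
Unset Strict Implicit.
Unset Printing Implicit Defensive.

Local Open Scope group_scope.

(** * Players *)

Definition opponent (P : player) : player := if P is Alice then Bob else Alice.

Lemma player_or P Q : P = Q \/ P = opponent Q.
Proof. by case: P; case: Q; [left|right|right|left]. Qed.

Lemma opponentK : involutive opponent.
Proof. by case. Qed.

Lemma neq_opponent P : P <> opponent P.
Proof. by case: P. Qed.

Lemma wins_opponent (C : finType) P (W : set (nat -> C)) alpha :
  ~ (wins P W alpha /\ wins (opponent P) W alpha).
Proof. by case: P => [] [/= ? ?]. Qed.

(** * Favorable elements of an ordered group *)

Section OrderedGroup.
Variables (G : groupType) (le : rel G).
Hypothesis le_og : ordered_group le.

(** Over closed walks, favorability is the sign that decides who wins a play
    repeating the walk forever; the identity counts for Bob. *)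
Definition favorable (P : player) (g : G) : bool :=
  if P is Alice then ~~ le 1 g else le 1 g.

Lemma og_refl : reflexive le. Proof. by case: le_og. Qed.
Lemma og_anti : antisymmetric le. Proof. by case: le_og. Qed.
Lemma og_trans : transitive le. Proof. by case: le_og. Qed.
Lemma og_total : total le. Proof. by case: le_og. Qed.

Lemma og_mull x a b : le (x * a) (x * b) = le a b.
Proof.
have mon x' a' b' : le a' b' -> le (x' * a') (x' * b').
  by case: le_og => _ _ _ _ /(_ a' b' x' 1) H /H; rewrite !mulg1.
by apply/idP/idP => [/(mon x^-1)|/mon//]; rewrite !mulKg.
Qed.

Lemma og_mulr x a b : le (a * x) (b * x) = le a b.
Proof.
have mon x' a' b' : le a' b' -> le (a' * x') (b' * x').
  by case: le_og => _ _ _ _ /(_ a' b' 1 x') H /H; rewrite !mul1g.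
by apply/idP/idP => [/(mon x^-1)|/mon//]; rewrite !mulgK.
Qed.

Lemma favorableN P g : favorable (opponent P) g = ~~ favorable P g.
Proof. by case: P; rewrite //= negbK. Qed.

Lemma favorable_mul P g h :
  favorable P g -> favorable P h -> favorable P (g * h).
Proof.
case: P => /= g1 h1; last by apply: og_trans g1 _; rewrite -{1}[g]mulg1 og_mull.
apply: contra h1 => gh1; apply: og_trans gh1 _.
have [//|le_g1] := orP (og_total 1 g); first by rewrite (negPf g1).
by rewrite -{2}[h]mul1g og_mulr.
Qed.

Lemma favorable_conj P x g : favorable P (x^-1 * g * x) = favorable P g.
Proof.
have e : le 1 (x^-1 * g * x) = le 1 g.
  by rewrite -(og_mull x) -(og_mulr x^-1) !mulgA mulgV mul1g mulgK mulg1 mulgV.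
by case: P; rewrite /= e.
Qed.

Lemma favorable_rot P x y : favorable P (x * y) = favorable P (y * x).
Proof. by rewrite -(favorable_conj P x) !mulgA mulVg mul1g. Qed.

Lemma favorable_exp P g n : favorable P g -> favorable P (g ^+ n.+1).
Proof.
by move=> fg; elim: n => [|n IHn]; rewrite ?expg1 // expgS favorable_mul.
Qed.

End OrderedGroup.

(** * Energy conditions *)

Lemma infinite_pigeonhole (Q : finType) (q : nat -> Q) :
  exists x, forall N, exists n, (N <= n)%N && (q n == x).
Proof.
apply: contrapT => no_x.
have /choice[B ltB] : forall x, exists N, forall n, q n = x -> (n < N)%N.
  move=> x; apply: contrapT => noN; apply: no_x; exists x => N.
  apply: contrapT => no_n; apply: noN; exists N => n qn; rewrite ltnNge.
  by apply/negP => leNn; apply: no_n; exists n; rewrite leNn qn eqxx.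
have := ltB _ (\max_x B x) erefl.
by rewrite ltnNge (leq_bigmax (F := B)).
Qed.

Lemma increasing_enum (p : pred nat) :
  (forall N, exists n, (N <= n)%N && p n) ->
  exists f : nat -> nat, [/\ forall k, (0 < f k)%N,
    forall k, (f k < f k.+1)%N & forall k, p (f k)].
Proof.
move=> infp; pose nxt N := ex_minn (infp N).
have nxtP N : (N <= nxt N)%N /\ p (nxt N).
  by rewrite /nxt; case: ex_minnP => n /andP[].
pose f := fix f k := if k is k'.+1 then nxt (f k').+1 else nxt 1%N.
exists f; split=> [[|k]|k|[|k]] /=; try exact: (nxtP _).1; try exact: (nxtP _).2.
by apply: leq_trans (nxtP _).1.
Qed.

Section EnergyCondition.
Variables (G : groupType) (le : rel G).
Hypothesis le_og : ordered_group le.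
Variables (C : finType) (val : C -> G).

Notation W := (energy_condition le val).
Notation favorable := (favorable le).

Lemma word_val_mkseq (alpha : nat -> C) n :
  word_val val (mkseq alpha n) = \prod_(0 <= k < n) val (alpha k).
Proof. by rewrite /word_val /mkseq big_map /index_iota subn0. Qed.

Lemma word_val_cat (v w : seq C) :
  word_val val (v ++ w) = word_val val v * word_val val w.
Proof. exact: big_cat. Qed.

(** For Alice, some label recurs forever, and the prefix values strictly
    decrease along its occurrences. For Bob, an infinite decreasing subsequence
    would visit some label twice, and its value would not have decreased in
    between. *)
Lemma cycles_win P (Q : finType) (q : nat -> Q) (alpha : nat -> C) :
  (forall i j, (i < j)%N -> q i = q j ->
     favorable P (\prod_(i <= k < j) val (alpha k))) ->
  wins P W alpha.
Proof.
move=> fav_cycle.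
have catu i j : (i <= j)%N -> word_val val (mkseq alpha j) =
    word_val val (mkseq alpha i) * \prod_(i <= k < j) val (alpha k).
  by move=> leij; rewrite !word_val_mkseq -big_cat_nat.
case: P fav_cycle => /= fav_cycle.
  have [x infx] := infinite_pigeonhole q.
  have [f [f0 f_inc fx]] := increasing_enum infx.
  exists f; split=> // k /=.
  have := fav_cycle _ _ (f_inc k); rewrite (eqP (fx k)) (eqP (fx _)).
  move=> /(_ erefl); rewrite (catu (f k) (f k.+1)) 1?ltnW //.
  set u := word_val _ _; set g := bigop _ _ _ => gn1.
  have := og_total le_og 1 g; rewrite (negPf gn1) /= => le_g1.
  split; first by rewrite -{2}[u]mulg1 (og_mull le_og).
  rewrite -{2}[u]mulg1 => /mulgI def_g.
  by rewrite def_g (og_refl le_og) in gn1.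
case=> f [f0 f_inc f_dec].
have lt_f i j : (i < j)%N -> (f i < f j)%N.
  move=> ltij; rewrite -(subnKC ltij); elim: (j - _)%N => [|d IHd].
    by rewrite addn0.
  by rewrite addnS; apply: ltn_trans IHd (f_inc _).
pose u n := word_val val (mkseq alpha n).
have dec i j : (i < j)%N -> le (u (f j)) (u (f i)) /\ u (f j) <> u (f i).
  move=> ltij; rewrite -(subnKC ltij); elim: (j - _)%N => [|d [IH1 IH2]].
    by rewrite addn0; apply: f_dec.
  rewrite addnS; have [le1 neq1] := f_dec (i.+1 + d)%N.
  have le2 := og_trans le_og le1 IH1.
  split=> // eq_u; apply: neq1; apply: (og_anti le_og).
  by apply/andP; split=> [|]; [exact: le1 | move: IH1; rewrite -eq_u].
have /injectivePn : ~~ injectiveb (fun i : 'I_#|Q|.+1 => q (f i)).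
  apply/injectiveP => /leq_card; rewrite card_ord ltnn //.
case=> i [j neq_ij eq_q].
have [k [l [ltkl eq_kl]]] : exists k l, (k < l)%N /\ q (f k) = q (f l).
  by case: (ltngtP i j) => [ltij|ltji|/ord_inj eqij];
    [exists i, j|exists j, i|rewrite eqij eqxx in neq_ij].
have := fav_cycle _ _ (lt_f _ _ ltkl) eq_kl.
rewrite -(og_mull le_og (u (f k))) mulg1 -catu; last exact/ltnW/lt_f.
have [le_u neq_u] := dec _ _ ltkl; move=> le_u'.
by apply: neq_u; apply: (og_anti le_og); rewrite le_u.
Qed.

Lemma energy_prefix_independent : prefix_independent W.
Proof.
move=> x alpha; set beta := fun k => _.
have ubeta n : word_val val (mkseq beta (size x + n)) =
    word_val val x * word_val val (mkseq alpha n).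
  rewrite -word_val_cat; congr word_val.
  rewrite /mkseq iotaD map_cat add0n -{2}[size x]addn0 iotaDl -map_comp.
  congr (_ ++ _); last first.
    by apply: eq_map => k /=; rewrite /beta ltnNge leq_addr /= addKn.
  apply: (@eq_from_nth _ (alpha 0%N)); rewrite size_map size_iota // => i ltix.
  by rewrite (nth_map 0%N) ?size_iota // nth_iota // /beta ltix.
split=> [[f [f0 f_inc f_dec]]|[f [f0 f_inc f_dec]]].
  exists (fun k => size x + f k)%N; split=> k.
  - by rewrite addn_gt0 f0 orbT.
  - by rewrite ltn_add2l.
  - rewrite /= !ubeta (og_mull le_og); have [? neq] := f_dec k.
    by split=> // /mulgI.
have ge_f k : (k < f k)%N by elim: k => // k IHk; apply: leq_ltn_trans (f_inc k).
pose g k := (f (size x + k) - size x)%N.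
have fg k : f (size x + k)%N = (size x + g k)%N.
  by rewrite /g subnKC // ltnW // (leq_ltn_trans _ (ge_f _)) ?leq_addr.
exists g; split=> k.
- by rewrite subn_gt0 (leq_ltn_trans _ (ge_f _)) ?leq_addr.
- by rewrite -(ltn_add2l (size x)) -!fg addnS.
- have := f_dec (size x + k)%N; rewrite /= -addnS !fg !ubeta (og_mull le_og).
  by case=> ? neq; split=> // eq_u; apply: neq; rewrite eq_u.
Qed.

Lemma wins_shift P (c : C) (alpha : nat -> C) :
  wins P W alpha ->
  wins P W (fun k => if k is k'.+1 then alpha k' else c).
Proof.
have := energy_prefix_independent [:: c] alpha.
set beta := fun k => _; set gamma := fun k => _.
have -> : beta = gamma by apply: funext => -[|k] //=; rewrite /beta /= subn1.
by case: P => /= -[? ?]; auto.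
Qed.

(** The value between two positions that are congruent modulo the period is a
    conjugate of a power of the value of the period. *)
Lemma omega_power_wins P n (c : 'I_n.+1 -> C) :
  favorable P (\prod_i val (c i)) -> wins P W (omega_power c).
Proof.
move=> fav_c; pose q k : 'I_n.+1 := inord (k %% n.+1).
apply: (@cycles_win P _ q) => i j ltij eq_q.
pose z k := \prod_(0 <= l < k) val (omega_power c l).
have z_add m k : z (m * n.+1 + k)%N = z n.+1 ^+ m * z k.
  elim: m k => [|m IHm] k; first by rewrite mul1g.
  rewrite expgS -mulgA -IHm mulSn -addnA /z.
  rewrite (@big_cat_nat _ _ _ n.+1) ?leq_addr //=; congr (_ * _).
  rewrite -{1}[n.+1]add0n big_addn addKn; apply: eq_bigr => l _.
  by rewrite /omega_power modnDr.
have z_period : z n.+1 = \prod_i val (c i).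
  rewrite /z big_mkord; apply: eq_bigr => l _.
  by rewrite /omega_power modn_small // inord_val.
have [m def_j] : exists m, j = (m.+1 * n.+1 + i)%N.
  have /eqP : i = j %[mod n.+1].
    by move/(congr1 (@nat_of_ord _)): eq_q; rewrite !inordK ?ltn_pmod.
  rewrite eq_sym eqn_mod_dvd 1?ltnW // => /dvdnP[[|m] def_m].
    by move: ltij; rewrite -subn_gt0 def_m.
  by exists m; rewrite -def_m subnK // ltnW.
have -> : \prod_(i <= k < j) val (omega_power c k) = (z i)^-1 * z n.+1 ^+ m.+1 * z i.
  by rewrite -mulgA -z_add -def_j /z (big_cat_nat (leq0n i) (ltnW ltij)) mulKg.
by rewrite favorable_conj // z_period favorable_exp.
Qed.

(** If no commutator were smaller than the identity, both [y * x <= x * y] and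
    [x * y <= y * x] would hold. *)
Lemma commutator_not_permuting (x x' y y' : C) :
  val x' = (val x)^-1 -> val y' = (val y)^-1 ->
  val x * val y <> val y * val x -> ~ permuting W.
Proof.
move=> valx valy ncomm perm_W.
have bad (s t s' t' : C) : val s' = (val s)^-1 -> val t' = (val t)^-1 ->
    ~~ favorable Alice (val s * val t * val s' * val t').
  move=> vals valt; apply/negP => fav.
  (* Exchanging the two middle letters leaves the value 1, favorable for Bob. *)
  pose c (i : 'I_4) := tnth [tuple s; t; s'; t'] i.
  have prod4 (d : 'I_4 -> C) : \prod_i val (d i) =
      val (d (inord 0)) * val (d (inord 1)) * val (d (inord 2)) * val (d (inord 3)).
    rewrite !big_ord_recl big_ord0 mulg1 !mulgA.
    do 3?congr (_ * _); congr (val (d _)); apply: ord_inj; rewrite /= ?inordK //.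
  have cE k : (k < 4)%N -> c (inord k) = nth s [:: s; t; s'; t'] k.
    by move=> ltk4; rewrite /c (tnth_nth s) inordK.
  have winA : W (omega_power c).
    by apply: (@omega_power_wins Alice); rewrite prod4 !cE.
  apply: (@wins_opponent _ Alice W _ (conj (perm_W _ c (tperm (inord 1) (inord 2)) winA) _)).
  apply: (@omega_power_wins Bob); rewrite prod4.
  rewrite tpermL tpermR !tpermD; try by rewrite -val_eqE /= !inordK.
  by rewrite !cE //= vals valt mulgV mul1g mulgV og_refl.
have := bad x y x' y' valx valy; have := bad y x y' x' valy valx.
rewrite /= !negbK valx valy => le1 le2; apply: ncomm.
apply: (og_anti le_og); apply/andP; split.
  by rewrite -(og_mulr le_og (val y)^-1) -(og_mulr le_og (val x)^-1) mulgK mulgV.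
by rewrite -(og_mulr le_og (val x)^-1) -(og_mulr le_og (val y)^-1) mulgK mulgV.
Qed.

End EnergyCondition.

(** * Safe nodes of edge-labelled graphs *)

Section Graphs.
Variables (G : groupType) (le : rel G).
Hypothesis le_og : ordered_group le.
Variables (C : finType) (val : C -> G) (V : finType).

Notation W := (energy_condition le val).
Notation E := (V * C * V)%type.
Notation weight := (fun e : E => val e.1.2).
Implicit Types (Gr : E -> Prop) (e : E) (h x c : seq E) (s t u v : V) (p : nat -> E).

Fixpoint walk Gr s h t : Prop :=
  if h is e :: h' then [/\ Gr e, e.1.1 = s & walk Gr e.2 h' t] else s = t.

Definition infinite_walk Gr s p : Prop :=
  [/\ (p 0%N).1.1 = s, forall n, Gr (p n) & forall n, (p n.+1).1.1 = (p n).2].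

(** A graph is the set of edges that a play may use, such as the edges left by a
    positional strategy. A node from which all reachable closed walks are
    favorable for [P] is won by [P] whatever path is followed; unlike winning,
    this property speaks of finite walks only. *)
Definition safe P Gr s : Prop :=
  forall x v c, walk Gr s x v -> walk Gr v c v -> c <> [::] ->
  favorable le P (word_val weight c).

Lemma walk_cat Gr s x v h t :
  walk Gr s x v -> walk Gr v h t -> walk Gr s (x ++ h) t.
Proof. by elim: x s => /= [|e x IHx] s => [->|[Gre src_e /IHx IH] /IH]. Qed.

Lemma walk_sub Gr Gr' s h t :
  (forall e, Gr e -> Gr' e) -> walk Gr s h t -> walk Gr' s h t.
Proof.
by move=> subGr; elim: h s => //= e h IHh s [/subGr ? ? /IHh].
Qed.

Lemma safe_sub P Gr Gr' s :
  (forall e, Gr' e -> Gr e) -> safe P Gr s -> safe P Gr' s.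
Proof.
move=> subGr safe_s x v c wx wc; apply: (safe_s x v c); exact: walk_sub subGr _.
Qed.

Lemma safe_step P Gr e : safe P Gr e.1.1 -> Gr e -> safe P Gr e.2.
Proof. by move=> safe_s Gre x v c wx; apply: (safe_s (e :: x)). Qed.

Lemma walk_segment Gr p i j :
  (i <= j)%N -> (forall n, (p n.+1).1.1 = (p n).2) ->
  (forall k, (i <= k < j)%N -> Gr (p k)) ->
  walk Gr (p i).1.1 [seq p k | k <- index_iota i j] (p j).1.1.
Proof.
move=> leij chain; rewrite -(subnKC leij); move: (j - i)%N => d.
elim: d i {leij} => [|d IHd] i Gr_p; first by rewrite addn0 /index_iota subnn.
rewrite /index_iota addKn /=; split=> //.
  by apply: Gr_p; rewrite leqnn addnS ltnS leq_addr.
rewrite -chain addnS -addSn; have := IHd i.+1; rewrite /index_iota addKn.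
by apply=> k /andP[ltik ltkj]; apply: Gr_p; rewrite ltnW // -addSnnS.
Qed.

Lemma word_val_segment p i j :
  word_val weight [seq p k | k <- index_iota i j] =
  \prod_(i <= k < j) val (p k).1.2.
Proof. by rewrite /word_val big_map. Qed.

Lemma segment_neq_nil p i j : (i < j)%N -> [seq p k | k <- index_iota i j] <> [::].
Proof.
by move=> ltij /(congr1 size); rewrite size_map size_iota => /eqP; rewrite subn_eq0 leqNgt ltij.
Qed.

Lemma safe_infinite_walk P Gr s p n :
  safe P Gr s -> infinite_walk Gr s p -> safe P Gr (p n).1.1.
Proof.
move=> safe_s [p0 Gr_p chain]; elim: n => [|n IHn]; first by rewrite p0.
by rewrite chain; apply: safe_step.
Qed.

Lemma safe_wins P Gr s p :
  safe P Gr s -> infinite_walk Gr s p -> wins P W (fun n => (p n).1.2).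
Proof.
move=> safe_s walk_p; have [_ Gr_p chain] := walk_p.
apply: (cycles_win le_og (q := fun n => (p n).1.1)) => i j ltij eq_ij.
rewrite -(word_val_segment p i j).
apply: (safe_infinite_walk safe_s walk_p (n := i) (x := [::]) (v := (p i).1.1)) => //; last first.
  exact: segment_neq_nil.
by rewrite {2}eq_ij; apply: walk_segment; rewrite // ltnW.
Qed.

Lemma walk_nth Gr s h t e0 i : walk Gr s h t -> (i < size h)%N ->
  Gr (nth e0 h i) /\
  (nth e0 h i).2 = if (i.+1 < size h)%N then (nth e0 h i.+1).1.1 else t.
Proof.
elim: h s i => //= e h IHh s [|i] [Gre _ wh] lti; last exact: IHh wh lti.
by split=> //; case: h {IHh lti} wh => //= e' h' [].
Qed.

Lemma closed_walk_wins P Gr v c :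
  walk Gr v c v -> c <> [::] -> favorable le P (word_val weight c) ->
  exists2 p, infinite_walk Gr v p & wins P W (fun n => (p n).1.2).
Proof.
case: c => // e c wc _ fav_c; pose N := (size c).+1.
pose p n := nth e (e :: c) (n %% N).
have ltN n : (n %% N < size (e :: c))%N by rewrite ltn_pmod.
have src_e : e.1.1 = v by case: wc.
exists p.
  split=> [|n|n]; first by rewrite /p mod0n.
    exact: (walk_nth e wc (ltN n)).1.
  rewrite /p (walk_nth e wc (ltN n)).2 /= ltnS modnS.
  (* The successor of an index wraps around exactly at the end of the cycle. *)
  case: ifPn => [dvd_n|ndvd_n]; last first.
    rewrite ifT //; have := ltN n; rewrite /= ltnS leq_eqVlt => /orP[/eqP eq_n|//].
    by case/negP: ndvd_n; rewrite /dvdn -addn1 -modnDml eq_n addn1 modnn.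
  rewrite ifF //; apply/negbTE; apply: contraTN dvd_n => lt_n.
  rewrite /dvdn -addn1 -modnDml addn1 modn_small //.
pose d (i : 'I_N) := (nth e (e :: c) i).1.2.
have -> : (fun n => (p n).1.2) = omega_power d.
  by apply: funext => n; rewrite /p /omega_power /d inordK ?ltn_pmod.
apply: (omega_power_wins le_og); move: fav_c; rewrite /word_val.
by rewrite (big_nth e) big_mkord.
Qed.

(** Follow a path to an unfavorable cycle and repeat the cycle forever; the path
    is dropped by prefix independence. *)
Lemma unsafe_loses P Gr s : ~ safe P Gr s ->
  exists2 p, infinite_walk Gr s p & wins (opponent P) W (fun n => (p n).1.2).
Proof.
move=> unsafe; have [x [v [c [wx wc c0 nfav]]]] : exists x v c,
    [/\ walk Gr s x v, walk Gr v c v, c <> [::] &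
        favorable le (opponent P) (word_val weight c)].
  apply: contrapT => no_c; apply: unsafe => x v c wx wc c0.
  apply/negPn/negP => nfav; apply: no_c; exists x, v, c.
  by rewrite favorableN.
have [p walk_p win_p] := closed_walk_wins wc c0 nfav.
elim: x s wx {unsafe} => [|e x IHx] s /= => [->|[Gre src_e wx]]; first by exists p.
have [q [q0 Gr_q chain] win_q] := IHx _ wx.
exists (fun n => if n is n'.+1 then q n' else e).
  by split=> // -[|n] //=; rewrite ?q0.
have := wins_shift le_og e.1.2 win_q; congr (wins _ _ _).
by apply: funext => -[].
Qed.

(** A play that switches between the graphs [Gr e], using after each visit of
    [u] the graph of the edge [e] just taken there. Labelling positions by the
    current graph and node, a closed segment without visit of [u] stays in a
    single graph. In a segment from [i] to [j] visiting [u] first at [a] and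
    last at [b], the loops at [u] between consecutive visits each lie in a
    single graph, and so does the walk from [b] to [j] prolonged by the one
    from [i] to [a], since the labels at [i] and [j] agree; the value of the
    segment is a conjugate of the product of these favorable values. The last
    hypothesis is an implication because, if [u] is not safe in the initial
    graph, then a play starting at a safe node never meets it. *)
Lemma switching_wins P (Gr : E -> E -> Prop) u p (m : nat -> E) :
  (forall n, (p n.+1).1.1 = (p n).2) ->
  (forall n, m n.+1 = if (p n).1.1 == u then p n else m n) ->
  (forall n, Gr (m n.+1) (p n)) ->
  safe P (Gr (m 0%N)) (p 0%N).1.1 ->
  (safe P (Gr (m 0%N)) u -> forall n, (p n).1.1 = u -> safe P (Gr (p n)) u) ->
  wins P W (fun n => (p n).1.2).
Proof.
move=> chain mS Gr_p safe0 safe_u.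
pose at_u n := (p n).1.1 == u.
have m_const i j : (i <= j)%N -> (forall k, (i <= k < j)%N -> ~~ at_u k) ->
    m j = m i.
  elim: j => [|j IHj]; first by rewrite leqn0 => /eqP->.
  rewrite leq_eqVlt => /orP[/eqP->//|]; rewrite ltnS => leij off_u.
  rewrite mS ifN; last by apply: off_u; rewrite leij leqnn.
  by apply: IHj => // k /andP[ik kj]; apply: off_u; rewrite ik ltnS ltnW.
have inv n : safe P (Gr (m n)) (p n).1.1 /\
    (m n = m 0%N \/ safe P (Gr (m 0%N)) u).
  elim: n => [|n [safe_n m_n]]; first by auto.
  have := Gr_p n; rewrite chain mS; case: eqP => [src_n|_] Gr_n.
    have u0 : safe P (Gr (m 0%N)) u by case: m_n => [m_n|//]; rewrite -m_n -src_n.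
    split; last by right.
    by apply: safe_step Gr_n; rewrite src_n; apply: safe_u.
  by split=> //; apply: safe_step Gr_n.
have safe_at_u n : at_u n -> safe P (Gr (p n)) u.
  move=> /eqP src_n; apply: safe_u => //; have [safe_n [m_n|//]] := inv n.
  by rewrite -m_n -src_n.
have seg i j M : (i <= j)%N -> (forall k, (i <= k < j)%N -> m k.+1 = M) ->
    walk (Gr M) (p i).1.1 [seq p k | k <- index_iota i j] (p j).1.1.
  move=> leij mM; apply: walk_segment => // k lt_k; rewrite -(mM k lt_k).
  exact: Gr_p.
have seg_off i j : (i <= j)%N -> (forall k, (i <= k < j)%N -> ~~ at_u k) ->
    walk (Gr (m i)) (p i).1.1 [seq p k | k <- index_iota i j] (p j).1.1.
  move=> leij off; apply: seg => // k /andP[ik kj].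
  rewrite mS ifN ?off ?ik //; apply: m_const => // l /andP[il lk].
  by rewrite off // il (ltn_trans lk).
have seg_u k j : (k < j)%N -> at_u k -> (forall l, (k < l < j)%N -> ~~ at_u l) ->
    walk (Gr (p k)) u [seq p l | l <- index_iota k j] (p j).1.1.
  move=> ltkj uk off; rewrite -(eqP uk); apply: seg => [|l]; first exact: ltnW.
  rewrite leq_eqVlt => /andP[/orP[/eqP<- _|kl lj]]; first by rewrite mS [_ == _]uk.
  have -> : p k = m k.+1 by rewrite mS [_ == _]uk.
  by apply: m_const => [|i /andP[ki il]]; [exact: ltnW | rewrite off // ki (leq_trans il)].
have loop_u j k : (k < j)%N -> at_u k -> at_u j ->
    favorable le P (\prod_(k <= l < j) val (p l).1.2).
  have [d] := ubnP (j - k); elim: d j k => // d IHd j k ltd ltkj uk uj.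
  have [[l [/andP[kl lj] ul]]|no_l] := EM (exists l, (k < l < j)%N /\ at_u l).
    rewrite (big_cat_nat (ltnW kl) (ltnW lj)) /=.
    by apply: (favorable_mul le_og); apply: IHd => //; lia.
  rewrite -word_val_segment; apply: (safe_at_u _ uk [::] u) => //.
    rewrite -{2}(eqP uj); apply: seg_u => // l klj.
    by apply/negP => ul; apply: no_l; exists l.
  exact: segment_neq_nil.
apply: (cycles_win le_og (q := fun n => (m n, (p n).1.1))) => i j ltij [eq_m eq_src].
have [[k0 k0P]|no_k] := EM (exists k, (i <= k < j)%N && at_u k); last first.
  rewrite -word_val_segment; apply: ((inv i).1 [::] (p i).1.1) => //.
    rewrite {2}eq_src; apply: seg_off; first exact: ltnW.
    by move=> k ikj; apply/negP => uk; apply: no_k; exists k; rewrite ikj.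
  exact: segment_neq_nil.
pose visit k := (i <= k < j)%N && at_u k.
have exv : exists k, visit k by exists k0.
have bnd k : visit k -> (k <= j)%N by case/andP => /andP[_ /ltnW].
case: (ex_minnP exv) => a /andP[/andP[ia aj] ua] min_a.
case: (ex_maxnP exv bnd) => b /andP[/andP[ib bj] ub] max_b.
have leab : (a <= b)%N by apply: min_a; rewrite /visit ib bj.
have off_a k : (i <= k < a)%N -> ~~ at_u k.
  move=> /andP[ik ka]; apply/negP => uk.
  suff: (a <= k)%N by lia.
  by apply: min_a; rewrite /visit uk andbT; lia.
have off_b k : (b < k < j)%N -> ~~ at_u k.
  move=> /andP[bk kj]; apply/negP => uk.
  suff: (k <= b)%N by lia.
  by apply: max_b; rewrite /visit uk andbT; lia.
have wb := seg_u b j bj ub off_b.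
have wa := seg_off i a ia off_a; rewrite (eqP ua) in wa.
have eq_mb : m i = p b.
  rewrite eq_m -[p b](_ : m b.+1 = _); last by rewrite mS [_ == _]ub.
  by apply: m_const => // k /andP[? ?]; apply: off_b; lia.
rewrite eq_mb eq_src in wa.
have fav_ba := safe_at_u b ub [::] u _ erefl (walk_cat wb wa).
have {}fav_ba : favorable le P
    ((\prod_(b <= k < j) val (p k).1.2) * (\prod_(i <= k < a) val (p k).1.2)).
  rewrite -!word_val_segment /word_val -big_cat; apply: fav_ba.
  by move/(congr1 size); rewrite size_cat !size_map !size_iota /=; lia.
rewrite (big_cat_nat ib (ltnW bj)) /= (favorable_rot le_og).
rewrite (big_cat_nat ia leab) /= mulgA.
(* A single visit: the middle part is empty, and 1 is not favorable for Alice. *)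
have [eq_ab|neq_ab] := eqVneq a b.
  by rewrite [X in _ * X]big_geq ?mulg1 // eq_ab.
by apply: (favorable_mul le_og) => //; apply: loop_u; rewrite // ltn_neqAle neq_ab.
Qed.

End Graphs.

(** * Plays and strategies *)

Section Plays.
Variables (C : finType) (A : arena C).
Notation V := (node A).
Notation E := (V * C * V)%type.
Implicit Types (s : V) (e : E) (h : seq E) (p : nat -> E) (P : player).

Lemma endpoint_rcons s h e : endpoint s (rcons h e) = target e.
Proof. by rewrite /endpoint map_rcons last_rcons. Qed.

Lemma endpoint_play s p n :
  is_play s p -> endpoint s (mkseq p n) = source (p n).
Proof.
case=> p0 _ chain; case: n => [|n]; first by rewrite p0.
by rewrite mkseqS endpoint_rcons chain.
Qed.

Lemma finite_path_rcons s h e :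
  finite_path s h -> e \in edges A -> source e = endpoint s h ->
  finite_path s (rcons h e).
Proof.
elim: h s => /= [|e' h IHh] s; first by move=> _ Ae ->.
by case=> Ae' src wh Ae src_e; split=> //; apply: IHh.
Qed.

Lemma default_move : exists f : V -> E, forall v, f v \in edges A /\ source (f v) = v.
Proof.
have /choice[f fP] : forall v, exists e : E, e \in edges A /\ source e = v.
  by move=> v; have [c [t Ae]] := edges_total v; exists (v, c, t).
by exists f.
Qed.

Lemma strategies_play s (tau : player -> seq E -> E) :
  (forall P, is_strategy P s (tau P)) ->
  exists p, is_play s p /\ forall P, consistent P (tau P) p.
Proof.
move=> strat; pose next h := tau (owner (endpoint s h)) h.
pose hist := fix hist n := if n is n'.+1 then rcons (hist n') (next (hist n')) else [::].
have path_hist n : finite_path s (hist n).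
  elim: n => //= n IHn; have [Ae src_e] := strat _ _ IHn erefl.
  exact: finite_path_rcons.
have nextP n : next (hist n) \in edges A /\
    source (next (hist n)) = endpoint s (hist n).
  exact: strat.
pose p n := next (hist n).
have mkseq_p n : mkseq p n = hist n.
  by elim: n => // n IHn; rewrite mkseqS IHn.
exists p; split.
  split=> [|n|n]; [exact: (nextP 0%N).2 | exact: (nextP n).1 |].
  by rewrite (nextP n.+1).2 /= endpoint_rcons.
by move=> P n; rewrite (nextP n).2 mkseq_p /p {1}/next => ->.
Qed.

End Plays.

(** * Positional determinacy *)

Section Determinacy.
Variables (G : groupType) (le : rel G).
Hypothesis le_og : ordered_group le.
Variables (C : finType) (val : C -> G).

Notation W := (energy_condition le val).
Notation safe := (safe le val).

Section PositionalGraph.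
Variables (V : finType) (owner : V -> player) (D : {set V * C * V}).
Notation E := (V * C * V)%type.

Definition positional_graph P (sigma : V -> E) (e : E) : Prop :=
  e \in D /\ (owner e.1.1 = P -> e = sigma e.1.1).

(** Stated for an edge set over fixed nodes, so that it passes to the smaller
    arenas of the induction without any transport of strategies. *)
Definition combinatorially_determined : Prop :=
  exists sigma : player -> V -> E,
    (forall P v, owner v = P -> sigma P v \in D /\ (sigma P v).1.1 = v) /\
    forall s, exists P, safe P (positional_graph P (sigma P)) s.

End PositionalGraph.

Section Arena.
Variable A : arena C.
Notation V := (node A).
Notation E := (V * C * V)%type.
Notation graph := (positional_graph (owner (a := A)) (edges A)).

Definition half_determined P : Prop :=
  exists sigma : V -> E, is_positional P sigma /\
    forall s, safe P (graph P sigma) s \/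
      exists2 tau, is_strategy (opponent P) s tau & winning (opponent P) W s tau.

Lemma half_determined_both :
  (forall P, half_determined P) -> combinatorially_determined (owner (a := A)) (edges A).
Proof.
move=> /choice[sigma halfP]; exists sigma; split; first by move=> P; apply: (halfP P).1.
move=> s; apply: contrapT => unsafe.
have /choice[tau tauP] : forall P, exists tau,
    is_strategy P s tau /\ winning P W s tau.
  move=> P; have [safe_s|] := (halfP (opponent P)).2 s.
    by case: unsafe; exists (opponent P).
  by rewrite opponentK => -[tau ? ?]; exists tau.
have [p [play_p cons_p]] := strategies_play (fun P => (tauP P).1).
apply: (@wins_opponent _ Alice W (fun n => color (p n))).
by split; apply: (tauP _).2.
Qed.

Lemma safe_winning P sigma s : safe P (graph P sigma) s ->
  winning P W s (positional_strategy s sigma).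
Proof.
move=> safe_s p play_p cons_p; apply: (safe_wins le_og safe_s).
have [p0 Ap chain] := play_p; split=> // n; split=> // owner_n.
by rewrite {1}cons_p // /positional_strategy endpoint_play.
Qed.

(** In a one-player arena, the opponent of [P] follows the play produced by an
    unfavorable cycle, and [P] has no way to leave it. *)
Lemma half_determined_no_choice P :
  (forall e1 e2, e1 \in edges A -> e2 \in edges A -> source e1 = source e2 ->
     owner (source e1) = P -> e1 = e2) ->
  half_determined P.
Proof.
move=> uniq_edge; have [f fP] := default_move A.
exists f; split=> [v _|s]; first exact: fP.
have [safe_s|/(unsafe_loses le_og)[p walk_p win_p]] := EM (safe P (graph P f) s).
  by left.
right; have play_p : is_play s p.
  by case: walk_p => p0 Gr_p chain; split=> // n; case: (Gr_p n).
(* Off the chosen play any legal move will do. *)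
pose tau h := if h == mkseq p (size h) then p (size h) else f (endpoint s h).
exists tau => [h _ _|q play_q cons_q].
  rewrite /tau; case: eqP => [def_h|_]; last exact: fP.
  by rewrite [in endpoint s h]def_h endpoint_play //; case: play_p.
suff -> : q = p by [].
apply: funext => n; have : mkseq q n.+1 = mkseq p n.+1.
  elim: n.+1 => // k IHk; rewrite !mkseqS IHk; congr rcons.
  have src_k : source (q k) = source (p k).
    by rewrite -!(endpoint_play _ play_q) -(endpoint_play _ play_p) IHk.
  have [owner_k|owner_k] := player_or (owner (source (q k))) P.
    by apply: uniq_edge => //; [case: play_q | case: play_p].
  by rewrite cons_q // IHk /tau size_mkseq eqxx.
by rewrite !mkseqS => /rcons_inj[].
Qed.

(** [D e] keeps [e] as the only move at [u]. Since [P] owns [u], a strategy of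
    [P] that is good in [D e] stays so in the full arena. The opponent plays
    with memory, following in the full arena the strategy for [D e] where [e] is
    the last move made at [u]. *)
Lemma half_determined_choice P u e1 e2 :
  (forall D : {set E}, (#|D| < #|edges A|)%N ->
     (forall s, exists c t, (s, c, t) \in D) ->
     combinatorially_determined (owner (a := A)) D) ->
  owner u = P -> e1 \in edges A -> e2 \in edges A ->
  source e1 = u -> source e2 = u -> e1 <> e2 -> half_determined P.
Proof.
move=> IH owner_u Ae1 Ae2 src1 src2 neq12.
pose valid e := e \in edges A /\ source e = u.
pose D e := [set x in edges A | (source x == u) ==> (x == e)].
have D_sub e x : x \in D e -> x \in edges A by rewrite inE => /andP[].
have /choice[sigma sigmaP] : forall e, exists sg : player -> V -> E, valid e ->
    (forall Q v, owner v = Q -> sg Q v \in D e /\ source (sg Q v) = v) /\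
    forall s, exists Q, safe Q (positional_graph (owner (a := A)) (D e) Q (sg Q)) s.
  move=> e; have [[Ae src_e]|not_valid] := EM (valid e); last by exists (fun _ _ => e).
  suff [sg [pos_sg safe_sg]] : combinatorially_determined (owner (a := A)) (D e).
    by exists sg.
  apply: IH => [|s].
    apply/proper_card/properP; split; first by apply/fintype.subsetP => x; apply: D_sub.
    have [eq1|neq1] := eqVneq e1 e; [exists e2 | exists e1] => //.
      by rewrite inE Ae2 src2 eqxx /= -eq1; apply/eqP => eq2; apply: neq12.
    by rewrite inE Ae1 src1 eqxx /= (negPf neq1).
  have [->|neq_su] := eqVneq s u.
    by exists e.1.2, e.2; rewrite -src_e -!surjective_pairing inE Ae src_e !eqxx.
  have [c [t Ast]] := edges_total s; exists c, t.
  by rewrite inE Ast /source /= (negPf neq_su).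
pose Q := opponent P; pose Gr e := positional_graph (owner (a := A)) (D e) Q (sigma e Q).
(* If [u] is unsafe for the opponent in some [D e], start from such an [e]. *)
have [e0 [valid0 e0P]] : exists e0, valid e0 /\
    (safe Q (Gr e0) u -> forall e, valid e -> safe Q (Gr e) u).
  have [[e0 [valid0 unsafe0]]|all_safe] := EM (exists e, valid e /\ ~ safe Q (Gr e) u).
    by exists e0.
  exists e1; split=> // _ e valid_e; apply: contrapT => unsafe.
  by apply: all_safe; exists e.
exists (sigma e0 P); split=> [v owner_v|s].
  by have [/D_sub] := (sigmaP e0 valid0).1 P v owner_v.
have [R safe_s] := (sigmaP e0 valid0).2 s.
have [eqR|eqR] := player_or R P; rewrite {R}eqR in safe_s; [left|right].
  apply: safe_sub safe_s => e [Ae pos_e]; split=> //.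
  have [src_e|neq_e] := eqVneq (source e) u; last by rewrite inE Ae (negPf neq_e).
  rewrite pos_e -/(source e) src_e //.
  by have [] := (sigmaP e0 valid0).1 P u owner_u.
pose mode := foldl (fun m e => if source e == u then e else m).
have valid_mode h t m : valid m -> finite_path t h -> valid (mode m h).
  elim: h t m => //= e h IHh t m valid_m [Ae _].
  by apply: IHh; case: eqP.
exists (fun h => sigma (mode e0 h) Q (endpoint s h)) => [h path_h owner_h|p play_p cons_p].
  by have [/D_sub] := (sigmaP _ (valid_mode h s _ valid0 path_h)).1 Q _ owner_h.
have [p0 Ap chain] := play_p.
have path_p n : finite_path s (mkseq p n).
  elim: n => // n IHn; rewrite mkseqS; apply: finite_path_rcons => //.
  by rewrite endpoint_play.
have modeS n : mode e0 (mkseq p n.+1) = if source (p n) == u then p n else mode e0 (mkseq p n).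
  by rewrite mkseqS /mode foldl_rcons.
apply: (switching_wins le_og (Gr := Gr) (u := u) (m := fun n => mode e0 (mkseq p n))) => //.
- move=> n; rewrite modeS; split.
    by rewrite inE Ap; case: eqP => //= ->.
  case: eqP => [src_n|_] owner_n.
    by case: (@neq_opponent P); rewrite -/Q -owner_u -src_n.
  by rewrite {1}cons_p // endpoint_play.
- by rewrite [(p 0%N).1.1]p0.
- by move=> safe_u n src_n; apply: e0P.
Qed.

End Arena.

Lemma edges_determined n (A : arena C) : (#|edges A| < n)%N ->
  combinatorially_determined (owner (a := A)) (edges A).
Proof.
elim: n A => // n IHn A ltn; apply: half_determined_both => P.
have [[u [e1 [e2 [owner_u [Ae1 src1] [Ae2 src2] neq12]]]]|no_choice] :=
  EM (exists u e1 e2, [/\ owner (a := A) u = P, e1 \in edges A /\ source e1 = u,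
        e2 \in edges A /\ source e2 = u & e1 <> e2]).
  apply: (@half_determined_choice A P u e1 e2) => // D ltD totD.
  by apply: (IHn (@Arena C (node A) (owner (a := A)) D totD)); apply: leq_trans ltD _.
apply: half_determined_no_choice => e1 e2 Ae1 Ae2 src12 owner1.
apply: contrapT => neq12; apply: no_choice; exists (source e1), e1, e2.
by split.
Qed.

Theorem uniform_positional_determinacy (A : arena C) :
  exists sigma : player -> node A -> node A * C * node A,
    (forall P, is_positional P (sigma P)) /\
    forall s, exists P, winning P W s (positional_strategy s (sigma P)).
Proof.
have [sigma [pos_sigma safe_sigma]] := edges_determined (ltnSn #|edges A|).
exists sigma; split=> [P v|s]; first exact: pos_sigma.
by have [P safe_s] := safe_sigma s; exists P; apply: safe_winning.
Qed.

Lemma positional_is_strategy (A : arena C) P (s : node A) sigma :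
  is_positional P sigma -> is_strategy P s (positional_strategy s sigma).
Proof. by move=> pos_sigma h _; apply: pos_sigma. Qed.

Lemma energy_half_positional : half_positional W.
Proof.
move=> A; have [sigma [pos_sigma win_sigma]] := uniform_positional_determinacy A.
exists (sigma Alice) => // s not_win; have [[//|win_s]] := win_sigma s.
by exists (positional_strategy s (sigma Bob)); first exact: positional_is_strategy.
Qed.

(** Exchanging the owners turns the game for the complement into a game for the
    condition itself. *)
Lemma energy_compl_half_positional : half_positional (~` W)%classic.
Proof.
move=> A; pose A' := @Arena C (node A) (fun v => opponent (owner v)) (edges A) (@edges_total C A).
have [sigma [pos_sigma win_sigma]] := uniform_positional_determinacy A'.
have pos P : @is_positional C A (opponent P) (sigma P).
  by move=> v owner_v; apply: (pos_sigma P v); rewrite /= owner_v opponentK.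
have cons P p s : @consistent C A (opponent P) (@positional_strategy C A s (sigma P)) p ->
    @consistent C A' P (@positional_strategy C A' s (sigma P)) p.
  by move=> cons_p n owner_n; apply: cons_p; rewrite -[LHS]opponentK; congr opponent.
exists (sigma Bob) => [|s not_win]; first exact: (pos Bob).
have [[win_s|win_s]] := win_sigma s; last first.
  by case: not_win => p play_p cons_p; apply: win_s => //; apply: cons.
exists (@positional_strategy C A s (sigma Alice)).
  exact: (@positional_is_strategy A Bob s _ (pos Alice)).
by move=> p play_p cons_p /=; apply; apply: win_s => //; apply: cons.
Qed.

End Determinacy.

(** * The Heisenberg group *)

(** The triple [(x, y, z)] stands for the unitriangular matrix with [x] and [y]
    above the diagonal and [z] in the corner. *)
Definition heisenberg : Type := (int * int * int)%type.
HB.instance Definition _ := Choice.on heisenberg.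

Definition heis_mul (g h : heisenberg) : heisenberg :=
  let: (x, y, z) := g in let: (x', y', z') := h in
  (x + x', y + y', z + z' + x * y')%R.
Definition heis_one : heisenberg := (0, 0, 0)%R.
Definition heis_inv (g : heisenberg) : heisenberg :=
  let: (x, y, z) := g in (- x, - y, x * y - z)%R.

Lemma heis_mulA : associative heis_mul.
Proof. by move=> [[x y] z] [[x' y'] z'] [[x2 y2] z2] /=; congr (_, _, _); lia. Qed.

Lemma heis_mul1 : left_id heis_one heis_mul.
Proof. by move=> [[x y] z] /=; congr (_, _, _); lia. Qed.

Lemma heis_mulr1 : right_id heis_one heis_mul.
Proof. by move=> [[x y] z] /=; congr (_, _, _); lia. Qed.

Lemma heis_mulV : left_inverse heis_one heis_inv heis_mul.
Proof. by move=> [[x y] z] /=; congr (_, _, _); lia. Qed.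

Lemma heis_mulrV : right_inverse heis_one heis_inv heis_mul.
Proof. by move=> [[x y] z] /=; congr (_, _, _); lia. Qed.

HB.instance Definition _ :=
  isGroup.Build heisenberg heis_mulA heis_mul1 heis_mulr1 heis_mulV heis_mulrV.

Definition heis_le : rel heisenberg := fun g h =>
  let: (x, y, z) := g in let: (x', y', z') := h in
  (x < x')%R || (x == x') && ((y < y')%R || (y == y') && (z <= z')%R).

(** Two-sided translations add constants to the first two coordinates and, among
    elements that agree on these, to the third. *)
Lemma heis_ordered : ordered_group heis_le.
Proof.
split.
- by move=> [[x y] z] /=; lia.
- move=> [[x y] z] [[x' y'] z'] /= le_both.
  by congr (_, _, _); lia.
- by move=> [[x y] z] [[x' y'] z'] [[x2 y2] z2] /=; lia.
- by move=> [[x y] z] [[x' y'] z'] /=; lia.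
- move=> [[x y] z] [[x' y'] z'] [[x2 y2] z2] [[x3 y3] z3] /=.
  have [->|?] := eqVneq x x'; last by lia.
  by have [->|?] := eqVneq y y'; lia.
Qed.

(** The first component selects a generator, the second one inverts it. *)
Definition heis_color : finType := (bool * bool)%type.
Definition heis_val (c : heis_color) : heisenberg :=
  let g : heisenberg := if c.1 then (1, 0, 0)%R else (0, 1, 0)%R in
  if c.2 then g^-1 else g.

(** * Conditions that are bi-positional but not permuting *)

Lemma energy_bi_positional_not_permuting (G : groupType) (le : rel G)
    (C : finType) (val : C -> G) (x x' y y' : C) :
  ordered_group le -> val x' = (val x)^-1 -> val y' = (val y)^-1 ->
  val x * val y <> val y * val x ->
  let W := energy_condition le val in
  [/\ prefix_independent W, bi_positional W & ~ permuting W].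
Proof.
move=> le_og vx vy ncomm W; split.
- exact: energy_prefix_independent.
- split; [exact: energy_half_positional | exact: energy_compl_half_positional].
- exact: (commutator_not_permuting le_og vx vy ncomm).
Qed.

Theorem mainTheorem3 :
  (exists (C : finType) (W : set (nat -> C)),
     [/\ (0 < #|C|)%N, prefix_independent W, bi_positional W & ~ permuting W]) /\
  (forall le : rel F2, ordered_group le ->
     [/\ prefix_independent (W1 le), bi_positional (W1 le) & ~ permuting (W1 le)]).
Proof.
split=> [|le le_og].
  exists heis_color, (energy_condition heis_le heis_val).
  have [] := @energy_bi_positional_not_permuting _ _ _ heis_val
    (true, false) (true, true) (false, false) (false, true) heis_ordered erefl erefl _ => //.
  by split=> //; rewrite card_prod card_bool.
have mem c : (c \in [:: gen_a; gen_a^-1; gen_b; gen_b^-1; 1 : F2]) ->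
    exists c5 : color5, val c5 = c by move=> c_in; exists (SeqSub c_in).
have [|a def_a] := mem gen_a; first by rewrite !inE eqxx.
have [|a' def_a'] := mem gen_a^-1; first by rewrite !inE eqxx !orbT.
have [|b def_b] := mem gen_b; first by rewrite !inE eqxx !orbT.
have [|b' def_b'] := mem gen_b^-1; first by rewrite !inE eqxx !orbT.
apply: (energy_bi_positional_not_permuting (x := a) (x' := a') (y := b) (y' := b'));
  by rewrite // ?def_a ?def_a' ?def_b ?def_b'.
Qed.
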